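(* Let $(X,M,\pi_1)$, $(Y,M,\pi_2)$ be bundles whose fibers are Banach spaces and $u:M\to M$ a map. Let $\varepsilon_1:M\to\mathbb R_+$ and let $i=0:M\to X\times Y$ be the zero section. Suppose that for every $m\in M$, $H_m\sim(F_m,G_m):X_m(r_1)\times Y_m(r_1')\to X_{u(m)}(r_2)\times Y_{u(m)}(r_2')$ is a correspondence with generating map, where $r_1,r_2,r_1',r_2'>0$ are independent of $m$ and $F_m:X_m(r_1)\times Y_{u(m)}(r_2')\to X_{u(m)}(r_2)$, $G_m:X_m(r_1)\times Y_{u(m)}(r_2')\to Y_m(r_1')$. Assume: (i) $|F_m(0,0)|\le\eta(u(m))$ and $|G_m(0,0)|\le\eta(m)$, where $\eta:M\to\mathbb R_+$ satisfies $\eta(u(m))\le\varepsilon(m)\eta(m)$ with $0\le\varepsilon(m)\le\varepsilon_1(m)$ for all $m\in M$; and one of the following two conditions holds: (ii) for every $m\in M$, $H_m$ satisfies the (A$'$)$(\alpha(m),\lambda_u(m))$ (B)$(\beta(m);\beta'(m),\lambda_s(m))$ condition, and (a) $\sup_m\alpha(m)\beta'(u(m))<1/2$, $\beta'(u(m))\le\beta(m)$ for all $m$, $\sup_m\{\alpha(m),\beta(m)\}<\infty$; (b) $\sup_m\dfrac{\lambda_u(m)\lambda_s(m)+\lambda_u(m)\varepsilon_1(m)}{1-\alpha(m)\beta'(u(m))}<1$, $\sup_m\lambda_s(m)<1$; (ii)$'$ or for every $m\in M$, $H_m$ satisfies the (A)$(\alpha(m);\alpha'(m),\lambda_u(m))$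 (B)$(\beta(m);\beta'(m),\lambda_s(m))$ condition, and (a)$'$ $\sup_m\alpha'(m)\beta'(u(m))<1/2$, $\alpha'(m)\le\alpha(u(m))$, $\beta'(u(m))\le\beta(m)$ for all $m$, $\sup_m\{\alpha(m),\beta(m)\}<\infty$; (b)$'$ $\sup_m\lambda_s(m)\lambda_u(m)<1$, $\sup_m\lambda_u(m)\varepsilon_1(m)<1$, $\sup_m\lambda_s(m)<1$. If $\eta_0>0$ is small and $\sup_m\eta(m)\le\eta_0$, then there is a small $\sigma_0>0$ such that there are unique maps $f_m:X_m(\sigma_0)\to Y_m$, $m\in M$, satisfying the following: (1) $\operatorname{Lip}f_m\le\beta'(m)$ and $|f_m(0)|\le K\eta(m)$ for some constant $K\ge0$. (2) $\operatorname{Graph}f\subset H^{-1}\operatorname{Graph}f$; more precisely, $(x_m(x),f_{u(m)}(x_m(x)))\in H_m(x,f_m(x))$ for all $x\in X_m(\sigma_0)$, where $x_m(\cdot):X_m(\sigma_0)\to X_{u(m)}(\sigma_0)$ satisfies $\operatorname{Lip}x_m(\cdot)\le\lambda_s(m)$ and $|x_m(0)|\le K_0\eta(u(m))$ for all $m\in M$ and some constant $K_0$. (3) $f$ does not depend on the choice of $\eta$: replacing $\eta$ by any $\eta':M\to\mathbb R_+$ such that $\eta'(u(m))\le\varepsilon'(m)\eta'(m)$, $\varepsilon'(m)\le\varepsilon_1(m)$ and $\eta(m)\le\eta'(m)\le\eta_0$ for all $m\in M$ yields the same $f$.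
   Context: For a Banach space $Z$ and $r>0$, $Z(r)=\{z\in Z:|z|<r\}$. A bundle $(X,M,\pi)$ is a surjection of sets $\pi:X\to M$, with fibers $X_m=\pi^{-1}(m)$ (here Banach spaces). A correspondence $H:A\to B$ is a nonempty subset $\operatorname{Graph}H\subset A\times B$; $H(a)=\{b:(a,b)\in\operatorname{Graph}H\}$; $A'\subset H^{-1}(B')$ means that for every $a\in A'$ there is $b\in B'$ with $b\in H(a)$. A correspondence $H:X_1\times Y_1\to X_2\times Y_2$ has generating map $(F,G)$ (written $H\sim(F,G)$), $F:X_1\times Y_2\to X_2$, $G:X_1\times Y_2\to Y_1$, if $(x_2,y_2)\in H(x_1,y_1)\iff y_1=G(x_1,y_2),\ x_2=F(x_1,y_2)$. $\operatorname{Graph}f=\bigcup_m\{m\}\times\operatorname{Graph}f_m$, and $\operatorname{Graph}f\subset H^{-1}\operatorname{Graph}f$ is meant fiberwise: $\operatorname{Graph}f_m\subset H_m^{-1}\operatorname{Graph}f_{u(m)}$ for all $m$. For $H\sim(F,G):X_1\times Y_1\to X_2\times Y_2$ and constants, conditions are required for all $(x_1,y_1)\times(x_2,y_2)$, $(x_1',y_1')\times(x_2',y_2')\in\operatorname{Graph}H$: (A)$(\alpha;\alpha',\lambda_u)$: if $|x_1-x_1'|\le\alpha|y_1-y_1'|$ then $|x_2-x_2'|\le\alpha'|y_2-y_2'|$ and $|y_1-y_1'|\le\lambda_u|y_2-y_2'|$. (B)$(\beta;\beta',\lambda_s)$: if $|y_2-y_2'|\le\beta|x_2-x_2'|$ then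 $|y_1-y_1'|\le\beta'|x_1-x_1'|$ and $|x_2-x_2'|\le\lambda_s|x_1-x_1'|$. (A$'$)$(\alpha,\lambda_u)$: $\sup_x\operatorname{Lip}F(x,\cdot)\le\alpha$ and $\sup_x\operatorname{Lip}G(x,\cdot)\le\lambda_u$. *)

(* Defs.v *)
From HB Require Import structures.
From mathcomp Require Import all_boot all_order all_algebra.
From mathcomp Require Import all_classical all_reals all_analysis.
Set Implicit Arguments.
Unset Strict Implicit.
Unset Printing Implicit Defensive.
Import Order.TTheory GRing.Theory Num.Theory.
Import numFieldNormedType.Exports.
Local Open Scope classical_set_scope.
Local Open Scope ring_scope.

(* A bundle over M with Banach fibers is represented by its family of fibers
   X : M -> completeNormedModType R.  A map between balls is represented by a
   total function; only its values on the balls are ever constrained. *)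

(* Z(r) *)
Definition oball {R : realType} (Z : normedModType R) (r : R) : set Z :=
  [set z | `|z| < r].
Arguments oball {R} Z r.

(* The supremum is taken in the extended reals: the real-valued [sup] is 0 by
   convention on unbounded sets. *)
Definition supf {R : realType} {M : Type} (a : M -> R) : \bar R :=
  ereal_sup [set (a m)%:E | m in [set: M]].

Definition nonneg {R : realType} {M : Type} (a : M -> R) : Prop :=
  forall m, 0 <= a m.

(* A correspondence is identified with its graph. *)
Definition correspondence {S T : Type} (A : set S) (B : set T)
    (H : set (S * T)) : Prop :=
  H !=set0 /\ H `<=` A `*` B.

(* H^{-1}(B) *)
Definition corr_preimage {S T : Type} (H : set (S * T)) (B : set T) : set S :=
  [set a | exists2 b, B b & H (a, b)].

Definition graph_on {S T : Type} (A : set S) (f : S -> T) : set (S * T) :=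
  [set p | A p.1 /\ p.2 = f p.1].

(* H ~ (F, G) for H : A1 x B1 -> A2 x B2 *)
Definition generating_map {X1 Y1 X2 Y2 : Type}
    (A1 : set X1) (B1 : set Y1) (A2 : set X2) (B2 : set Y2)
    (H : set ((X1 * Y1) * (X2 * Y2)))
    (F : X1 -> Y2 -> X2) (G : X1 -> Y2 -> Y1) : Prop :=
  [/\ forall x1 y2, A1 x1 -> B2 y2 -> A2 (F x1 y2),
      forall x1 y2, A1 x1 -> B2 y2 -> B1 (G x1 y2)
    & forall x1 y1 x2 y2, A1 x1 -> B1 y1 -> A2 x2 -> B2 y2 ->
        (H ((x1, y1), (x2, y2)) <-> y1 = G x1 y2 /\ x2 = F x1 y2)].

Section ConeConditions.
Context {R : realType} {X1 Y1 X2 Y2 : normedModType R}.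

Definition condA (H : set ((X1 * Y1) * (X2 * Y2))) (alpha alpha' lu : R) :=
  forall x1 y1 x2 y2 x1' y1' x2' y2',
    H ((x1, y1), (x2, y2)) -> H ((x1', y1'), (x2', y2')) ->
    `|x1 - x1'| <= alpha * `|y1 - y1'| ->
    `|x2 - x2'| <= alpha' * `|y2 - y2'| /\ `|y1 - y1'| <= lu * `|y2 - y2'|.

Definition condB (H : set ((X1 * Y1) * (X2 * Y2))) (beta beta' ls : R) :=
  forall x1 y1 x2 y2 x1' y1' x2' y2',
    H ((x1, y1), (x2, y2)) -> H ((x1', y1'), (x2', y2')) ->
    `|y2 - y2'| <= beta * `|x2 - x2'| ->
    `|y1 - y1'| <= beta' * `|x1 - x1'| /\ `|x2 - x2'| <= ls * `|x1 - x1'|.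

(* (A'), for a generating map (F, G) with domain A1 x B2 *)
Definition condA' (A1 : set X1) (B2 : set Y2)
    (F : X1 -> Y2 -> X2) (G : X1 -> Y2 -> Y1) (alpha lu : R) :=
  forall x, A1 x -> alpha.-lipschitz_B2 (F x) /\ lu.-lipschitz_B2 (G x).

End ConeConditions.

Section Bundles.
Context {R : realType} {M : Type} (X Y : M -> completeNormedModType R).
Variable u : M -> M.

Definition hyp_corr (r1 r1' r2 r2' : R)
    (H : forall m, set ((X m * Y m) * (X (u m) * Y (u m))))
    (F : forall m, X m -> Y (u m) -> X (u m))
    (G : forall m, X m -> Y (u m) -> Y m) : Prop :=
  forall m,
    correspondence (oball (X m) r1 `*` oball (Y m) r1')
      (oball (X (u m)) r2 `*` oball (Y (u m)) r2') (H m) /\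
    generating_map (oball (X m) r1) (oball (Y m) r1')
      (oball (X (u m)) r2) (oball (Y (u m)) r2') (H m) (F m) (G m).

Definition hyp_i
    (F : forall m, X m -> Y (u m) -> X (u m))
    (G : forall m, X m -> Y (u m) -> Y m)
    (eps1 eta : M -> R) : Prop :=
  [/\ forall m, `|F m 0 0| <= eta (u m) /\ `|G m 0 0| <= eta m,
      nonneg eta
    & exists eps : M -> R, forall m,
        eta (u m) <= eps m * eta m /\ 0 <= eps m <= eps1 m].

Definition hyp_ii (r1 r2' : R)
    (H : forall m, set ((X m * Y m) * (X (u m) * Y (u m))))
    (F : forall m, X m -> Y (u m) -> X (u m))
    (G : forall m, X m -> Y (u m) -> Y m)
    (eps1 alpha beta beta' lu ls : M -> R) : Prop :=
  [/\ forall m,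
        condA' (oball (X m) r1) (oball (Y (u m)) r2') (F m) (G m)
          (alpha m) (lu m) /\
        condB (H m) (beta m) (beta' m) (ls m),
      [/\ (supf (fun m => alpha m * beta' (u m))%R < (1 / 2)%R%:E)%E,
          forall m, beta' (u m) <= beta m
        & (supf (fun m => Num.max (alpha m) (beta m))%R < +oo)%E]
    & (supf (fun m => (lu m * ls m + lu m * eps1 m) /
                      (1 - alpha m * beta' (u m)))%R < 1%R%:E)%E /\
      (supf ls < 1%R%:E)%E].

Definition hyp_ii'
    (H : forall m, set ((X m * Y m) * (X (u m) * Y (u m))))
    (eps1 alpha alpha' beta beta' lu ls : M -> R) : Prop :=
  [/\ forall m,
        condA (H m) (alpha m) (alpha' m) (lu m) /\
        condB (H m) (beta m) (beta' m) (ls m),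
      [/\ (supf (fun m => alpha' m * beta' (u m))%R < (1 / 2)%R%:E)%E,
          forall m, alpha' m <= alpha (u m),
          forall m, beta' (u m) <= beta m
        & (supf (fun m => Num.max (alpha m) (beta m))%R < +oo)%E]
    & [/\ (supf (fun m => ls m * lu m)%R < 1%R%:E)%E,
          (supf (fun m => lu m * eps1 m)%R < 1%R%:E)%E
        & (supf ls < 1%R%:E)%E]].

Definition lip_section (s : R) (beta' eta : M -> R)
    (f : forall m, X m -> Y m) : Prop :=
  (forall m, (beta' m).-lipschitz_(oball (X m) s) (f m)) /\
  exists2 K : R, 0 <= K & forall m, `|f m 0| <= K * eta m.

Definition invariant_graph (s : R)
    (H : forall m, set ((X m * Y m) * (X (u m) * Y (u m))))
    (ls eta : M -> R) (f : forall m, X m -> Y m) : Prop :=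
  (forall m, graph_on (oball (X m) s) (f m) `<=`
     corr_preimage (H m) (graph_on (oball (X (u m)) s) (f (u m)))) /\
  exists (xi : forall m, X m -> X (u m)) (K0 : R), forall m,
    [/\ forall x, oball (X m) s x -> oball (X (u m)) s (xi m x),
        forall x, oball (X m) s x ->
          H m ((x, f m x), (xi m x, f (u m) (xi m x))),
        (ls m).-lipschitz_(oball (X m) s) (xi m)
      & `|xi m 0| <= K0 * eta (u m)].

Definition solution (s : R)
    (H : forall m, set ((X m * Y m) * (X (u m) * Y (u m))))
    (beta' ls eta : M -> R) (f : forall m, X m -> Y m) : Prop :=
  lip_section s beta' eta f /\ invariant_graph s H ls eta f.

Definition agree (s : R) (f g : forall m, X m -> Y m) : Prop :=
  forall m x, oball (X m) s x -> f m x = g m x.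

Definition unique_solution (s : R)
    (H : forall m, set ((X m * Y m) * (X (u m) * Y (u m))))
    (beta' ls eta : M -> R) (f : forall m, X m -> Y m) : Prop :=
  solution s H beta' ls eta f /\
  forall g, solution s H beta' ls eta g -> agree s g f.

End Bundles.

(* Main.v *)
Require Import Defs.
From HB Require Import structures.
From mathcomp Require Import all_boot all_order all_algebra.
From mathcomp Require Import all_classical all_reals all_analysis.
From mathcomp Require Import ring lra.
Set Implicit Arguments.
Unset Strict Implicit.
Import Order.TTheory GRing.Theory Num.Theory.
Import numFieldNormedType.Exports.
Local Open Scope classical_set_scope.
Local Open Scope ring_scope.

(** Work with the generating maps [(F, G)] only. If [f] is fibrewise [beta']-Lipschitz and [|f 0| <= K eta], then
    [x' = F(x, f x')] has a unique small solution, and [x |-> G(x, f x')] is again [beta']-Lipschitz by (B): this is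
    the graph transform, and [f] is the pointwise limit of its iterates [f_n] on the zero section.

    Under (A') one step of the transform contracts the distance of two sections at [x] by
    [lu / (1 - alpha beta')], measured at [x']; under (A) the two points above [x] are followed along their whole
    orbits, which stay in a common cone, so that each step only costs [lu]. In both cases a section at [x] is bounded by
    a multiple of [|x| + D eta], which shrinks fast enough along orbits for these factors to win; this gives
    convergence of [f_n] and uniqueness alike.

    The bound [|f_n 0| <= K eta] is immediate under (A'). Under (A) a direct one-step estimate would lose a factor
    [1 / (1 - alpha' beta')], so [f_n] is compared with the iterates of the translated system [F - F(0,0)],
    [G - G(0,0)], which fixes [0] and satisfies the same cone conditions. *)

(** * Fixed points and geometric limits in Banach spaces *)

Lemma contraction_fixpoint {R : realType} {V : completeNormedModType R}
    (T : V -> V) (z : V) (rho q : R) :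
  0 <= rho -> 0 <= q < 1 ->
  (forall x y, `|z - x| <= rho -> `|z - y| <= rho ->
     `|T x - T y| <= q * `|x - y|) ->
  `|z - T z| <= (1 - q) * rho ->
  exists2 p, `|z - p| <= rho & p = T p.
Proof.
move=> rho0 /andP[q0 q1] Tq Tz.
pose U := [set x : V | `|z - x| <= rho].
have Uz : U z by rewrite /U /= subrr normr0.
(* The displacement of the centre and the contraction add up to at most [(1 - q) * rho + q * rho],
   so [T] preserves the closed ball. *)
have TU : {homo T : x / U x >-> U x}.
  move=> x Ux; rewrite /U /=.
  have := Tq _ _ Uz Ux.
  have := ler_distD (T z) z (T x).
  have : q * `|z - x| <= q * rho by exact: ler_wpM2l.
  lra.
pose f : {fun U >-> U} := HB.pack T (isFun.Build _ _ _ _ T TU).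
have [p Up pT] : exists2 p, U p & p = f p; last by exists p.
apply: banach_fixed_point.
- exists (NngNum q0); split => //= -[x y] [/= Ux Uy].
  exact: Tq.
- have -> : U = closed_ball_ Num.norm z rho by [].
  exact: closed_closed_ball_.
- by exists z.
Qed.

Lemma le_geometric {R : realType} (x b C t : R) :
  0 <= t < 1 -> (forall n, x <= b + C * t ^+ n) -> x <= b.
Proof.
move=> /andP[t0 t1] H.
apply: (@ler_cvg_to _ \oo _ R (fun=> x) (fun n => b + C * t ^+ n)).
- exact: cvg_cst.
- rewrite -[X in _ --> X]addr0; apply: cvgD; first exact: cvg_cst.
  by apply: (@cvg_geometric R C t); rewrite ger0_norm.
- exact: nearW.
Qed.

Lemma geometric_limit {R : realType} {V : completeNormedModType R} (v : nat -> V)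
    (C t : R) : 0 <= t < 1 -> (forall n, `|v n.+1 - v n| <= C * t ^+ n) ->
  exists l, forall n, `|v n - l| <= C / (1 - t) * t ^+ n.
Proof.
move=> /andP[t0 t1] H.
have C0 : 0 <= C by have := le_trans (normr_ge0 _) (H 0%N); rewrite expr0 mulr1.
(* The factor [1 - t ^+ k] comes from the partial geometric sum; it makes the induction on [k] close
   and is then dropped for a bound uniform in [k]. *)
have part n k : `|v (n + k)%N - v n| <= C / (1 - t) * t ^+ n * (1 - t ^+ k).
  elim: k => [|k IH]; first by rewrite addn0 subrr normr0 expr0 subrr mulr0.
  rewrite addnS; apply: le_trans (ler_distD (v (n + k)%N) _ _) _.
  apply: le_trans (lerD (H _) IH) _.
  suff -> : C * t ^+ (n + k) = C / (1 - t) * t ^+ n * (t ^+ k - t ^+ k.+1).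
    by rewrite -mulrDr; lra.
  by rewrite exprS exprD; field; lra.
have bnd n k : `|v (n + k)%N - v n| <= C / (1 - t) * t ^+ n.
  apply: le_trans (part n k) _; apply: ler_piMr.
    by apply: mulr_ge0; [rewrite divr_ge0 // subr_ge0 ltW | exact: exprn_ge0].
  by rewrite lerBlDr lerDl exprn_ge0.
have vcvg : cvgn v.
  have -> : v = (fun n => v 0%N) \+ series (telescope v).
    by apply/funext => n; rewrite [LHS]eq_sum_telescope.
  apply: is_cvgD; first exact: is_cvg_cst.
  apply: normed_cvg; apply: (@series_le_cvg _ _ (geometric C t)).
  - by move=> n; exact: normr_ge0.
  - by move=> n; rewrite /geometric /= mulr_ge0 // exprn_ge0.
  - exact: H.
  - by apply: is_cvg_geometric_series; rewrite ger0_norm.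
exists (limn v) => n; rewrite distrC.
apply: (@ler_cvg_to _ \oo _ R (fun k => `|v (n + k)%N - v n|)
  (fun=> C / (1 - t) * t ^+ n)).
- apply: cvg_norm; apply: cvgB; last exact: cvg_cst.
  have -> : (fun k => v (n + k)%N) = [sequence v (k + n)%N]_k.
    by apply/funext => k; rewrite addnC.
  by rewrite cvg_shiftn.
- exact: cvg_cst.
- by apply: nearW => k; exact: bnd.
Qed.

(** * Hyperbolic systems and their graph transform *)

Section GraphTransform.
Context {R : realType} {M : Type} {X Y : M -> completeNormedModType R}.
Context {u : M -> M}.
Implicit Types (f g : forall m, X m -> Y m) (F : forall m, X m -> Y (u m) -> X (u m)).
Implicit Types (G : forall m, X m -> Y (u m) -> Y m).

(** What the two alternative hypotheses share: [a] is [alpha] under (A') and [alpha'] under (A),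
    where the Lipschitz bounds come from pairs of points with equal first coordinate. [A], [B] and
    [lam] are bounds uniform in [m]. *)
Record hyperbolic (r s A B lam : R) (a beta beta' lu ls : M -> R) F G : Prop :=
  Hyperbolic {
    hyp_a : forall m, 0 <= a m <= A;
    hyp_beta' : forall m, 0 <= beta' m;
    hyp_beta : forall m, beta' (u m) <= beta m <= B;
    hyp_gap : forall m, a m * beta' (u m) <= 1 / 2;
    hyp_lu : forall m, 0 <= lu m;
    hyp_ls : forall m, 0 <= ls m <= lam;
    hyp_lam : lam < 1;
    hyp_F : forall m x y y', `|x| < r -> `|y| < s -> `|y'| < s ->
      `|F m x y - F m x y'| <= a m * `|y - y'|;
    hyp_G : forall m x y y', `|x| < r -> `|y| < s -> `|y'| < s ->
      `|G m x y - G m x y'| <= lu m * `|y - y'|;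
    hyp_B : forall m x x' y y', `|x| < r -> `|x'| < r -> `|y| < s -> `|y'| < s ->
      `|y - y'| <= beta m * `|F m x y - F m x' y'| ->
      `|G m x y - G m x' y'| <= beta' m * `|x - x'| /\
      `|F m x y - F m x' y'| <= ls m * `|x - x'| }.

Definition lip_on (sigma : R) (beta' : M -> R) f :=
  forall m x x', `|x| < sigma -> `|x'| < sigma ->
    `|f m x - f m x'| <= beta' m * `|x - x'|.

Definition small_at0 (K : R) (eta : M -> R) f := forall m, `|f m 0| <= K * eta m.

(** For small Lipschitz [f] and [x] in the ball the set is a singleton, by [fp_exists] and [fp_lip];
    elsewhere the chosen value carries no meaning. *)
Definition graph_point (sigma : R) F f m x : X (u m) :=
  xget 0 [set x' | `|x'| < sigma /\ x' = F m x (f (u m) x')].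
Arguments graph_point : clear implicits.

Definition graph_transform (sigma : R) F G f : forall m, X m -> Y m :=
  fun m x => G m x (f (u m) (graph_point sigma F f m x)).
Arguments graph_transform : clear implicits.

Lemma section_bound sigma K (eta beta' : M -> R) f : lip_on sigma beta' f ->
  small_at0 K eta f ->
  forall m (x : X m), `|x| < sigma -> `|f m x| <= K * eta m + beta' m * `|x|.
Proof.
move=> f_lip f_0 m x xs.
have x0 : `|0 : X m| < sigma by rewrite normr0; apply: le_lt_trans xs.
have := f_lip _ _ _ xs x0; rewrite subr0.
have := f_0 m; have := ler_distD 0 (f m x) (f m 0).
have := ler_distD (f m 0) (f m x) 0.
by rewrite !subr0 => ? ? ? ?; lra.
Qed.

(** [adm_etaK] keeps the fixed point over [0] within [(1 - lam) * sigma / 3] of the origin, which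
    leaves room for continuation inside the ball; [adm_etaKs] keeps the values of sections in the
    ball of radius [s], where [F] and [G] are controlled. *)
Record admissible (r s A B lam sigma eta0 K : R) : Prop := Admissible {
  adm_sigma : 0 < sigma;
  adm_sigma_r : sigma <= r;
  adm_K : 0 <= K;
  adm_A : 0 <= A;
  adm_etaK : (1 + A * K) * eta0 <= (1 - lam) * sigma / 6;
  adm_etaKs : K * eta0 + B * sigma < s }.

(** * One step of the graph transform *)

Section Step.
Context {r s A B lam : R} {a beta beta' lu ls : M -> R} {F G}.
Arguments F : clear implicits.
Arguments G : clear implicits.
Context {sigma eta0 K : R} {eta : M -> R}.
Hypothesis FG : hyperbolic r s A B lam a beta beta' lu ls F G.
Hypothesis adm : admissible r s A B lam sigma eta0 K.
Hypothesis eta_bnd : forall m, 0 <= eta m <= eta0.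
Hypothesis F00 : forall m, `|F m 0 0| <= eta (u m).

Let sigma_gt0 : 0 < sigma := adm_sigma adm.
Let sigma_le : sigma <= r := adm_sigma_r adm.
Let K_ge0 : 0 <= K := adm_K adm.
Let etaK := adm_etaK adm.
Let etaKs := adm_etaKs adm.

Let lt_r (m : M) (x : X m) : `|x| < sigma -> `|x| < r.
Proof. by move=> /lt_le_trans; apply. Qed.

Section FixedSection.
Context {f : forall m, X m -> Y m}.
Arguments f : clear implicits.
Hypothesis f_lip : lip_on sigma beta' f.
Hypothesis f_0 : small_at0 K eta f.

Let fp m x x' := `|x'| < sigma /\ x' = F m x (f (u m) x').
Arguments fp : clear implicits.

Lemma section_in m (x : X (u m)) : `|x| < sigma -> `|f (u m) x| < s.
Proof.
move=> xs; have := section_bound f_lip f_0 xs.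
have /andP[b1 b2] := hyp_beta FG m.
have b0 := hyp_beta' FG (u m).
have /andP[e0 e1] := eta_bnd (u m).
have : K * eta (u m) <= K * eta0 by exact: ler_wpM2l.
have : beta' (u m) * `|x| <= B * sigma by apply: ler_pM; rewrite ?(ltW xs)//; lra.
move: etaKs; lra.
Qed.

(** On the graph of [f] the cone hypothesis of (B) holds because [beta' (u m) <= beta m]. The case
    [x = z] also shows that the fixed point is unique. *)
Lemma fp_lip m (x z : X m) x' z' : `|x| < sigma -> `|z| < sigma -> fp m x x' -> fp m z z' ->
  `|G m x (f (u m) x') - G m z (f (u m) z')| <= beta' m * `|x - z| /\
  `|x' - z'| <= ls m * `|x - z|.
Proof.
move=> xs zs [x's x'E] [z's z'E].
have := hyp_B FG (lt_r xs) (lt_r zs) (section_in x's) (section_in z's).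
rewrite -x'E -z'E; apply.
apply: le_trans (f_lip x's z's) _.
by apply: ler_wpM2r => //; case/andP: (hyp_beta FG m).
Qed.

(** Since [a m * beta' (u m) <= 1 / 2], half of the norm of [x'] is absorbed on the left, which
    doubles the remaining terms. *)
Lemma fp0_bound m x' : fp m 0 x' -> `|x'| <= 2 * (1 + A * K) * eta (u m).
Proof.
move=> [x's x'E].
have s_gt0 : 0 < s by apply: le_lt_trans (section_in x's).
have x0 : `|0 : X m| < r by rewrite normr0; apply: lt_le_trans sigma_le.
have y0 : `|0 : Y (u m)| < s by rewrite normr0.
have := hyp_F FG x0 (section_in x's) y0; rewrite -x'E subr0.
have := F00 m; have := ler_distD (F m 0 0) x' 0; rewrite !subr0.
have := section_bound f_lip f_0 x's.
have /andP[a0 aA] := hyp_a FG m => h1 h2 h3 h4.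
have : a m * `|f (u m) x'| <= a m * (K * eta (u m) + beta' (u m) * `|x'|).
  exact: ler_wpM2l.
have /andP[e0 e1] := eta_bnd (u m).
have : a m * (K * eta (u m)) <= A * (K * eta (u m)).
  by apply: ler_wpM2r => //; apply: mulr_ge0.
have : a m * beta' (u m) * `|x'| <= 1 / 2 * `|x'|.
  by apply: ler_wpM2r => //; exact: hyp_gap FG m.
lra.
Qed.

Lemma fp_bound m x x0' x' : `|x| < sigma -> fp m 0 x0' -> fp m x x' ->
  `|x'| <= ls m * `|x| + 2 * (1 + A * K) * eta (u m).
Proof.
move=> xs f0 fx; have x0 : `|0 : X m| < sigma by rewrite normr0.
have [_] := fp_lip xs x0 fx f0; rewrite subr0.
have := fp0_bound f0.
have := ler_distD x0' x' 0; rewrite !subr0; lra.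
Qed.

(** The bound [rho / 2] is [(1 - q) * rho] for the contraction constant [q = 1 / 2], which dominates
    [a m * beta' (u m)]. *)
Lemma fp_near m (x : X m) z rho : 0 <= rho -> `|x| < sigma -> `|z| + rho < sigma ->
  `|z - F m x (f (u m) z)| <= rho / 2 -> exists x', fp m x x'.
Proof.
move=> rho0 xs zs zF.
have inball w : `|z - w| <= rho -> `|w| < sigma.
  by have := ler_distD z w 0; rewrite !subr0 (distrC w); lra.
have half : 0 <= (1 / 2 : R) < 1 by lra.
have [||p zp pE] := @contraction_fixpoint R (X (u m)) (fun w => F m x (f (u m) w))
  z rho (1 / 2) rho0 half.
- move=> w v /inball ws /inball vs.
  have := hyp_F FG (lt_r xs) (section_in ws) (section_in vs).
  have /andP[a0 _] := hyp_a FG m.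
  have : a m * `|f (u m) w - f (u m) v| <= a m * (beta' (u m) * `|w - v|).
    by apply: ler_wpM2l => //; exact: f_lip.
  have : a m * beta' (u m) * `|w - v| <= 1 / 2 * `|w - v|.
    by apply: ler_wpM2r => //; exact: hyp_gap FG m.
  lra.
- lra.
by exists p; split => //; exact: inball.
Qed.

(* The fixed point is continued along the ray from [0] to [x]: by [hyp_B] it stays in a ball of radius
   [lam * sigma + rho], so at each step the contraction may be run in a ball of fixed radius [rho]. *)
Lemma fp_exists m (x : X m) : `|x| < sigma -> exists x', fp m x x'.
Proof.
have /andP[ls0 lsl] := hyp_ls FG m; have lam1 := hyp_lam FG.
have /andP[a0 aA] := hyp_a FG m; have /andP[e0 e1] := eta_bnd (u m).
pose rho : R := (1 - lam) * sigma / 3.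
have rho0 : 0 < rho by rewrite divr_gt0 // mulr_gt0 // subr_gt0.
have K0 : 2 * (1 + A * K) * eta (u m) <= rho.
  have : (1 + A * K) * eta (u m) <= (1 + A * K) * eta0.
    apply: ler_wpM2l => //; apply: addr_ge0 => //; apply: mulr_ge0 => //; lra.
  rewrite /rho; move: etaK; lra.
have x0 : `|0 : X m| < sigma by rewrite normr0.
have u0 : `|0 : X (u m)| < sigma by rewrite normr0.
have s_gt0 : 0 < s by apply: le_lt_trans (section_in u0).
have y0 : `|0 : Y (u m)| < s by rewrite normr0.
have AK0 : 0 <= A * K by apply: mulr_ge0 => //; lra.
have [x0' f0] : exists x', fp m 0 x'.
  apply: (@fp_near _ _ 0 rho) => //; first exact: ltW.
    rewrite normr0 add0r /rho.
    have : 0 <= lam * sigma by apply: mulr_ge0; [lra | exact: ltW].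
    move: sigma_gt0; lra.
  rewrite sub0r normrN.
  have := hyp_F FG (lt_r x0) (section_in u0) y0; rewrite subr0.
  have := F00 m; have := ler_distD (F m 0 0) (F m 0 (f (u m) 0)) 0; rewrite !subr0.
  have : a m * `|f (u m) 0| <= A * (K * eta (u m)) by apply: ler_pM.
  lra.
suff main n : forall x : X m, `|x| < sigma -> `|x| <= n%:R * (rho / 2) ->
    exists x', fp m x x'.
  move=> xs.
  apply: (main (Num.bound (`|x| / (rho / 2)))) => //.
  have h0 : 0 < rho / 2 by exact: divr_gt0.
  rewrite -ler_pdivrMr //; apply/ltW/archi_boundP.
  by rewrite divr_ge0 // ltW.
elim: n => [|n IHn] {}x xs xn.
  by move: xn; rewrite mul0r normr_le0 => /eqP ->; exists x0'.
(* The point [t *: x] lies one step back on the ray: its norm is at most [n%:R * (rho / 2)] and its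
   distance to [x] at most [rho / 2]. *)
pose t : R := n%:R / n.+1%:R.
have t0 : 0 <= t by rewrite divr_ge0.
have t1 : t <= 1 by rewrite ler_pdivrMr // mul1r ler_nat.
have txm : `|t *: x| = t * `|x| by rewrite normrZ ger0_norm.
have txs : `|t *: x| < sigma.
  by rewrite txm; apply: le_lt_trans xs; rewrite ler_piMl.
have [|z fz] := IHn _ txs.
  rewrite txm /t mulrAC ler_pdivrMr // -mulrA ler_wpM2l //.
  by rewrite mulrC.
have xxm : `|t *: x - x| <= rho / 2.
  rewrite -{2}[x]scale1r -scalerBl normrZ distrC ger0_norm ?subr_ge0 //.
  have -> : 1 - t = n.+1%:R^-1.
    have n0 : n.+1%:R != 0 :> R by rewrite pnatr_eq0.
    by apply: (mulIf n0); rewrite mulVf // mulrBl mul1r divfK // -natrB // subSnn.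
  by rewrite ler_pdivrMl.
apply: (@fp_near _ _ z rho) => //; first exact: ltW.
  have := fp_bound txs f0 fz.
  have : ls m * `|t *: x| <= lam * sigma by apply: ler_pM => //; exact: ltW.
  rewrite /rho in K0 *; move: K0.
  have : 0 < (1 - lam) * sigma by rewrite mulr_gt0 // subr_gt0.
  lra.
case: fz => zs zE; rewrite {1}zE.
(* With equal second coordinates the cone hypothesis of (B) is trivial, so passing from [t *: x] to
   [x] moves [F] by at most [ls m] times their distance. *)
have : `|f (u m) z - f (u m) z| <= beta m * `|F m (t *: x) (f (u m) z) - F m x (f (u m) z)|.
  rewrite subrr normr0 mulr_ge0 //; case/andP: (hyp_beta FG m) => + _.
  by apply: le_trans; exact: hyp_beta' FG _.
move=> /(hyp_B FG (lt_r txs) (lt_r xs) (section_in zs) (section_in zs)) [_].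
move=> /le_trans; apply; apply: le_trans xxm.
rewrite ler_piMl //; lra.
Qed.

Lemma graph_pointP m (x : X m) : `|x| < sigma -> fp m x (graph_point sigma F f m x).
Proof. by move=> /fp_exists[x' fx]; exact: (xgetPex 0 (ex_intro _ x' fx)). Qed.

Lemma graph_point_bound m (x : X m) : `|x| < sigma ->
  `|graph_point sigma F f m x| <= ls m * `|x| + 2 * (1 + A * K) * eta (u m).
Proof.
move=> xs; have x0 : `|0 : X m| < sigma by rewrite normr0.
by apply: fp_bound xs (graph_pointP x0) (graph_pointP xs).
Qed.

Lemma graph_point0_bound m :
  `|graph_point sigma F f m 0| <= 2 * (1 + A * K) * eta (u m).
Proof. by apply: fp0_bound; apply: graph_pointP; rewrite normr0. Qed.

Lemma graph_point_lip m (x z : X m) : `|x| < sigma -> `|z| < sigma ->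
  `|graph_point sigma F f m x - graph_point sigma F f m z| <= ls m * `|x - z|.
Proof.
by move=> xs zs; case: (fp_lip xs zs (graph_pointP xs) (graph_pointP zs)).
Qed.

Lemma graph_transform_lip : lip_on sigma beta' (graph_transform sigma F G f).
Proof.
move=> m x z xs zs.
by case: (fp_lip xs zs (graph_pointP xs) (graph_pointP zs)).
Qed.

End FixedSection.
End Step.

(** * Merging of orbits of sections *)

Definition chain_step (s sigma K0 : R) (ls eta : M -> R) F G f g :=
  forall m x, `|x| < sigma -> exists x', [/\ `|x'| < sigma,
    `|x'| <= ls m * `|x| + K0 * eta (u m), `|g (u m) x'| < s,
    x' = F m x (g (u m) x') & f m x = G m x (g (u m) x')].

(** Both the Picard iterates and any solution, repeated at every index, are chains. The latter is
    why [chain_step] asks for some [x'] rather than for [graph_point], and why no smallness is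
    imposed on [K] and [K0]. *)
Definition is_chain (s sigma K K0 : R) (beta' ls eta : M -> R) F G
    (phi : nat -> forall m, X m -> Y m) :=
  forall n, [/\ lip_on sigma beta' (phi n), small_at0 K eta (phi n)
              & chain_step s sigma K0 ls eta F G (phi n.+1) (phi n)].

(** Applied to the iterates and their shift by one this gives convergence; applied to two constant
    chains it gives uniqueness. *)
Definition chains_merge (s sigma : R) (beta' ls eta : M -> R) F G :=
  forall K K0 (phi psi : nat -> forall m, X m -> Y m), 0 <= K -> 0 <= K0 ->
  is_chain s sigma K K0 beta' ls eta F G phi ->
  is_chain s sigma K K0 beta' ls eta F G psi ->
  exists2 t : R, 0 <= t < 1 & forall m x, `|x| < sigma ->
    exists C : R, forall n, `|phi n m x - psi n m x| <= C * t ^+ n.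

Definition coneA (r s : R) (alpha a lu : M -> R) F G :=
  forall m x x' y y', `|x| < r -> `|x'| < r -> `|y| < s -> `|y'| < s ->
    `|x - x'| <= alpha m * `|G m x y - G m x' y'| ->
    `|F m x y - F m x' y'| <= a m * `|y - y'| /\
    `|G m x y - G m x' y'| <= lu m * `|y - y'|.

(** With [t] halfway between [th] and [1], the constant [D] is taken so large that the slack
    [(t - th) * D] pays for the perturbation [K0 * th]. *)
Lemma weight_decay (c ls eps1 eta : M -> R) (th K0 : R) : 0 <= th < 1 -> 0 <= K0 ->
  (forall m, 0 <= c m) -> (forall m, c m * ls m <= th) ->
  (forall m, c m * eps1 m <= th) -> (forall m, 0 <= eta m) ->
  (forall m, eta (u m) <= eps1 m * eta m) ->
  exists D t : R, [/\ 1 <= D, 0 <= t < 1 & forall m (x v : R), 0 <= x ->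
    v <= ls m * x + K0 * eta (u m) ->
    c m * (v + D * eta (u m)) <= t * (x + D * eta m)].
Proof.
move=> /andP[th0 th1] K00 c0 cls ceps eta0 etau.
pose D := 1 + 2 * (K0 * th / (1 - th)); pose t := (1 + th) / 2.
have D1 : 1 <= D.
  by rewrite lerDl mulr_ge0 // divr_ge0 ?mulr_ge0 // subr_ge0 ltW.
have Dth : (K0 + D) * th <= t * D.
  have -> : t * D = D * th + (1 - th) / 2 + K0 * th by rewrite /D /t; field; lra.
  lra.
exists D, t; split => //; first by rewrite /t; apply/andP; split; lra.
move=> m x v x0 vle.
have h1 : c m * v <= c m * (ls m * x + K0 * eta (u m)) by exact: ler_wpM2l.
have h2 : c m * ls m * x <= th * x by exact: ler_wpM2r.
have h3 : c m * eta (u m) <= c m * (eps1 m * eta m) by exact: ler_wpM2l.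
have h4 : c m * eps1 m * eta m <= th * eta m by exact: ler_wpM2r.
have h5 : (K0 + D) * (c m * eta (u m)) <= (K0 + D) * (th * eta m).
  by apply: ler_wpM2l; lra.
have h6 : (K0 + D) * th * eta m <= t * D * eta m by exact: ler_wpM2r.
have h7 : th * x <= t * x by apply: ler_wpM2r => //; rewrite /t; lra.
lra.
Qed.

Section Merge.
Context {r s A B lam : R} {a beta beta' lu ls : M -> R} {F G}.
Arguments F : clear implicits.
Arguments G : clear implicits.
Context {sigma th : R} {eta eps1 : M -> R}.
Hypothesis FG : hyperbolic r s A B lam a beta beta' lu ls F G.
Hypothesis sigma_r : sigma <= r.
Hypothesis th01 : 0 <= th < 1.
Hypothesis eta_ge0 : forall m, 0 <= eta m.
Hypothesis eta_u : forall m, eta (u m) <= eps1 m * eta m.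
Hypothesis eps1_ge0 : forall m, 0 <= eps1 m.

Let lt_r (m : M) (x : X m) : `|x| < sigma -> `|x| < r.
Proof. by move=> /lt_le_trans; apply. Qed.

Let section_weight K f (D C : R) m (x : X m) : lip_on sigma beta' f ->
  small_at0 K eta f -> `|x| < sigma -> 1 <= D -> 0 <= K -> K <= C -> beta' m <= C ->
  `|f m x| <= C * (`|x| + D * eta m).
Proof.
move=> fl f0 xs D1 K0 KC bC; have := section_bound fl f0 xs.
have : beta' m * `|x| <= C * `|x| by exact: ler_wpM2r.
have : K * eta m <= C * (D * eta m).
  by apply: ler_pM => //; rewrite ler_peMl.
lra.
Qed.

Lemma chains_merge_lip :
  (forall m, lu m * ls m + lu m * eps1 m <= th * (1 - a m * beta' (u m))) ->
  chains_merge s sigma beta' ls eta F G.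
Proof.
move=> gap K K0 phi psi K_ge0 K0_ge0 phiP psiP.
pose c m := lu m / (1 - a m * beta' (u m)).
have d_gt0 m : 0 < 1 - a m * beta' (u m) by have := hyp_gap FG m; lra.
have c0 m : 0 <= c m by rewrite divr_ge0 ?(hyp_lu FG) // ltW.
have cls m : c m * ls m <= th.
  rewrite /c mulrAC ler_pdivrMr //; apply: le_trans (gap m).
  by rewrite lerDl mulr_ge0 // (hyp_lu FG).
have ceps m : c m * eps1 m <= th.
  rewrite /c mulrAC ler_pdivrMr //; apply: le_trans (gap m).
  by rewrite lerDr mulr_ge0 ?(hyp_lu FG) //; case/andP: (hyp_ls FG m).
have [D [t [D1 t01 W]]] := weight_decay th01 K0_ge0 c0 cls ceps eta_ge0 eta_u.
have t0 : 0 <= t by case/andP: t01.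
exists t => // m x xs.
(* One constant serves the whole orbit: after the first step [beta' (u m) <= beta m <= B], and only
   the starting [beta' m] may exceed [B]. *)
suff main C n : forall m (x : X m), `|x| < sigma -> K <= C -> B <= C -> beta' m <= C ->
    `|phi n m x - psi n m x| <= 2 * C * (`|x| + D * eta m) * t ^+ n.
  pose C := K + `|B| + beta' m; exists (2 * C * (`|x| + D * eta m)) => n.
  have b0 := hyp_beta' FG m; have := ler_norm B; have := normr_ge0 B => ? ?.
  by apply: main => //; rewrite /C; lra.
elim: n => [|n IHn] {}m {}x {}xs KC BC bC.
  have [phil phi0 _] := phiP 0%N; have [psil psi0 _] := psiP 0%N.
  have := section_weight phil phi0 xs D1 K_ge0 KC bC.
  have := section_weight psil psi0 xs D1 K_ge0 KC bC.
  by have := ler_normB (phi 0%N m x) (psi 0%N m x); rewrite expr0; lra.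
have [_ _ /(_ _ _ xs)[x1 [x1s x1b y1s x1E ->]]] := phiP n.
have [psil _ /(_ _ _ xs)[x2 [x2s x2b y2s x2E ->]]] := psiP n.
have /andP[bb bB] := hyp_beta FG m.
have := IHn _ _ x1s KC BC (le_trans bb (le_trans bB BC)).
set y1 := phi n (u m) x1 in y1s x1E *; set y2 := psi n (u m) x2 in y2s x2E *.
set e := `|_ - _| => he.
have y12 : `|y1 - y2| <= e + beta' (u m) * `|x1 - x2|.
  apply: le_trans (ler_distD (psi n (u m) x1) _ _) _.
  by rewrite lerD2l; exact: psil.
have x12 := hyp_F FG (lt_r xs) y1s y2s; rewrite -x1E -x2E in x12.
have g12 := hyp_G FG (lt_r xs) y1s y2s.
(* The images [x1] and [x2] differ by at most [a m] times the difference of [y1] and [y2]; moving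
   that term to the left produces the denominator of [c]. *)
have : `|y1 - y2| * (1 - a m * beta' (u m)) <= e.
  have : beta' (u m) * `|x1 - x2| <= beta' (u m) * (a m * `|y1 - y2|).
    by apply: ler_wpM2l => //; exact: hyp_beta' FG _.
  lra.
rewrite -ler_pdivlMr // => y12'.
apply: le_trans g12 _.
have -> : 2 * C * (`|x| + D * eta m) * t ^+ n.+1 =
    2 * C * t ^+ n * (t * (`|x| + D * eta m)) by rewrite exprS; ring.
have C0 : 0 <= 2 * C * t ^+ n.
  by rewrite mulr_ge0 ?exprn_ge0 // mulr_ge0 //; lra.
apply: le_trans (ler_wpM2l C0 (W m _ _ (normr_ge0 x) x1b)).
apply: le_trans (ler_wpM2l (hyp_lu FG m) y12') _.
have -> : lu m * (e / (1 - a m * beta' (u m))) = c m * e by rewrite /c; ring.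
rewrite mulrCA; apply: ler_wpM2l => //.
by rewrite mulrAC.
Qed.

(** The orbits start at one point, where the cone relation is trivial, and [a m <= alpha (u m)]
    carries it to the images. These may differ, so the induction runs over pairs [x], [z] and the
    bound involves the weights of both. *)
Lemma chains_merge_cone (alpha : M -> R) : coneA r s alpha a lu F G ->
  (forall m, 0 <= alpha m) -> (forall m, a m <= alpha (u m)) ->
  (forall m, lu m * ls m <= th) -> (forall m, lu m * eps1 m <= th) ->
  chains_merge s sigma beta' ls eta F G.
Proof.
move=> HA alpha0 a_alpha luls lueps K K0 phi psi K_ge0 K0_ge0 phiP psiP.
have [D [t [D1 t01 W]]] :=
  weight_decay th01 K0_ge0 (hyp_lu FG) luls lueps eta_ge0 eta_u.
have t0 : 0 <= t by case/andP: t01.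
exists t => // m x xs.
suff main C n : forall m (x z : X m), `|x| < sigma -> `|z| < sigma ->
    K <= C -> B <= C -> beta' m <= C ->
    `|x - z| <= alpha m * `|phi n m x - psi n m z| ->
    `|phi n m x - psi n m z| <=
      C * ((`|x| + D * eta m) + (`|z| + D * eta m)) * t ^+ n.
  pose C := K + `|B| + beta' m.
  exists (C * ((`|x| + D * eta m) + (`|x| + D * eta m))) => n.
  have b0 := hyp_beta' FG m; have := ler_norm B; have := normr_ge0 B => ? ?.
  by apply: main => //; rewrite /C ?subrr ?normr0 ?mulr_ge0 //; lra.
elim: n => [|n IHn] {}m {}x z {}xs zs KC BC bC.
  move=> _; have [phil phi0 _] := phiP 0%N; have [psil psi0 _] := psiP 0%N.
  have := section_weight phil phi0 xs D1 K_ge0 KC bC.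
  have := section_weight psil psi0 zs D1 K_ge0 KC bC.
  by have := ler_normB (phi 0%N m x) (psi 0%N m z); rewrite expr0; lra.
have [_ _ /(_ _ _ xs)[x1 [x1s x1b y1s x1E ->]]] := phiP n.
have [_ _ /(_ _ _ zs)[x2 [x2s x2b y2s x2E ->]]] := psiP n.
move=> /(HA _ _ _ _ _ (lt_r xs) (lt_r zs) y1s y2s); rewrite -x1E -x2E => -[x12 y12].
have /andP[bb bB] := hyp_beta FG m.
have cone : `|x1 - x2| <= alpha (u m) * `|phi n (u m) x1 - psi n (u m) x2|.
  by apply: le_trans x12 _; exact: ler_wpM2r.
have ih := IHn _ _ _ x1s x2s KC BC (le_trans bb (le_trans bB BC)) cone.
apply: le_trans y12 _; apply: le_trans (ler_wpM2l (hyp_lu FG m) ih) _.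
have C0 : 0 <= C * t ^+ n by rewrite mulr_ge0 ?exprn_ge0 //; lra.
have := ler_wpM2l C0 (W m _ _ (normr_ge0 x) x1b).
have := ler_wpM2l C0 (W m _ _ (normr_ge0 z) x2b).
rewrite exprS; lra.
Qed.

End Merge.

(** * Convergence of the Picard iterates to an invariant section *)

Definition picard (sigma : R) F G (n : nat) : forall m, X m -> Y m :=
  iter n (graph_transform sigma F G) (fun m _ => 0).
Arguments picard : clear implicits.

Section Existence.
Context {r s A B lam : R} {a beta beta' lu ls : M -> R} {F G}.
Arguments F : clear implicits.
Arguments G : clear implicits.
Context {sigma eta0 K : R} {eta : M -> R}.
Hypothesis FG : hyperbolic r s A B lam a beta beta' lu ls F G.
Hypothesis adm : admissible r s A B lam sigma eta0 K.
Hypothesis eta_bnd : forall m, 0 <= eta m <= eta0.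
Hypothesis F00 : forall m, `|F m 0 0| <= eta (u m).

Let lt_r (m : M) (x : X m) : `|x| < sigma -> `|x| < r.
Proof. by move=> /lt_le_trans; apply; exact: adm_sigma_r adm. Qed.

Lemma graph_transform_step f : lip_on sigma beta' f -> small_at0 K eta f ->
  chain_step s sigma (2 * (1 + A * K)) ls eta F G (graph_transform sigma F G f) f.
Proof.
move=> fl f0 m x xs; exists (graph_point sigma F f m x).
have [gs gE] := graph_pointP FG adm eta_bnd F00 fl f0 xs.
split => //; first exact (graph_point_bound FG adm eta_bnd F00 fl f0 xs).
exact (section_in FG adm eta_bnd fl f0 gs).
Qed.

Lemma picard_lip : (forall n, small_at0 K eta (picard sigma F G n)) ->
  forall n, lip_on sigma beta' (picard sigma F G n).
Proof.
move=> small; elim => [m x x' _ _|n IHn].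
  by rewrite subrr normr0 mulr_ge0 // (hyp_beta' FG).
exact (graph_transform_lip FG adm eta_bnd F00 IHn (small n)).
Qed.

Lemma invariant_section_exists :
  (forall n, small_at0 K eta (picard sigma F G n)) ->
  chains_merge s sigma beta' ls eta F G ->
  exists f, [/\ lip_on sigma beta' f, small_at0 K eta f &
    forall m x, `|x| < sigma -> f m x = graph_transform sigma F G f m x].
Proof.
move=> small merge; have lips := picard_lip small.
have K0 : 0 <= K := adm_K adm.
have K00 : 0 <= 2 * (1 + A * K).
  by rewrite mulr_ge0 // addr_ge0 // mulr_ge0 // (adm_A adm).
have chainP N : is_chain s sigma K (2 * (1 + A * K)) beta' ls eta F G
    (fun n => picard sigma F G (n + N)%N).
  by move=> n; split => //; rewrite addSn; exact: graph_transform_step.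
have [t t01 rate] := merge _ _ _ _ K0 K00 (chainP 1%N) (chainP 0%N).
have t0 : 0 <= t by case/andP: t01.
pose lim m x (l : Y m) := exists C, forall n, `|picard sigma F G n m x - l| <= C * t ^+ n.
pose f m x : Y m := xget 0 [set l | lim m x l].
have fP m x : `|x| < sigma -> lim m x (f m x).
  move=> xs; suff [l lP] : exists l, lim m x l by exact: (xgetPex 0 (ex_intro _ l lP)).
  have [C HC] := rate m x xs.
  have [|l Hl] := @geometric_limit R (Y m) (fun n => picard sigma F G n m x) C t t01.
    by move=> n; have := HC n; rewrite addn1 addn0.
  by exists l, (C / (1 - t)).
have fl : lip_on sigma beta' f.
  move=> m x z xs zs; have [C1 H1] := fP m x xs; have [C2 H2] := fP m z zs.
  apply: (@le_geometric _ _ _ (C1 + C2) t) => // n.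
  have := H1 n; have := H2 n; have := lips n m x z xs zs.
  set p := picard _ _ _ _ _ _; set q := picard _ _ _ _ _ _.
  have := ler_distD p (f m x) (f m z); have := ler_distD q p (f m z).
  rewrite (distrC (f m x) p); lra.
have f0 : small_at0 K eta f.
  move=> m; have s0 : `|0 : X m| < sigma by rewrite normr0 (adm_sigma adm).
  have [C H] := fP m 0 s0; apply: (@le_geometric _ _ _ C t) => // n.
  have := H n; have := small n m; set p := picard _ _ _ _ _ _.
  by have := ler_distD p (f m 0) 0; rewrite !subr0 distrC; lra.
exists f; split => // m x xs.
have [gs gE] := graph_pointP FG adm eta_bnd F00 fl f0 xs.
have ys := section_in FG adm eta_bnd fl f0 gs.
set x' := graph_point sigma F f m x in gs gE ys.
have [C1 H1] := fP _ _ gs; have [C2 H2] := fP _ _ xs.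
apply/eqP; rewrite -subr_eq0 -normr_le0.
have lu0 := hyp_lu FG m.
(* The iterate of index [n.+1] is inserted between [f] and its transform: up to [t ^+ n], its
   distance to [f] is at most [C2 * t], and [lu m * (2 * C1)] bounds the change of [G] between [yn]
   and [y]. *)
apply: (@le_geometric _ _ _ (C2 * t + lu m * (2 * C1)) t) => // n.
have /= H2n := H2 n.+1; rewrite exprS in H2n.
have [gns gnE] := graph_pointP FG adm eta_bnd F00 (lips n) (small n) xs.
have yns := section_in FG adm eta_bnd (lips n) (small n) gns.
set y := f (u m) x' in gE ys *.
move: H2n; rewrite {1}/graph_transform -/(picard _ _ _ _).
set xn' := graph_point _ _ _ _ _ in gns gnE yns *.
set yn := picard sigma F G n (u m) xn' in gnE yns * => H2n.
have g12 := hyp_G FG (lt_r xs) ys yns.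
have x12 := hyp_F FG (lt_r xs) ys yns; rewrite -gE -gnE in x12.
have b0 := hyp_beta' FG (u m).
(* The two graph points differ; this costs at most half of the difference of [y] and [yn] itself,
   and absorbing it gives the factor [2]. *)
have y12 : `|y - yn| <= 2 * (C1 * t ^+ n).
  have := ler_distD (picard sigma F G n (u m) x') y yn.
  have h1 := H1 n; rewrite distrC -/y in h1.
  have := lips n _ _ _ gs gns; rewrite -/yn.
  have : beta' (u m) * `|x' - xn'| <= beta' (u m) * (a m * `|y - yn|).
    exact: ler_wpM2l.
  have : a m * beta' (u m) * `|y - yn| <= 1 / 2 * `|y - yn|.
    by apply: ler_wpM2r => //; exact: hyp_gap FG m.
  lra.
have := ler_wpM2l lu0 y12.
rewrite /graph_transform -/x' -/y add0r.
have := ler_distD (G m x yn) (f m x) (G m x y).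
rewrite !(distrC (f m x)) (distrC (G m x yn) (G m x y)).
lra.
Qed.

(** The condition on [K] reads [1 + th * (K + B) <= K]: the [1] pays for [G m 0 0], and
    [th * (K + B)] for the value of [f] at the graph point over [0]. The denominator
    [1 - a m * beta' (u m)] is already part of the gap hypothesis. *)
Lemma graph_transform_small (th : R) (eps1 : M -> R) f :
  (forall m, `|G m 0 0| <= eta m) -> 0 <= th -> 1 + th * B <= (1 - th) * K ->
  (forall m, 0 <= eps1 m) -> (forall m, eta (u m) <= eps1 m * eta m) ->
  (forall m, lu m * ls m + lu m * eps1 m <= th * (1 - a m * beta' (u m))) ->
  lip_on sigma beta' f -> small_at0 K eta f ->
  small_at0 K eta (graph_transform sigma F G f).
Proof.
move=> G00 th0 KB eps0 etau gap fl f0 m.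
have s0 : `|0 : X m| < sigma by rewrite normr0 (adm_sigma adm).
have [gs gE] := graph_pointP FG adm eta_bnd F00 fl f0 s0.
have ys := section_in FG adm eta_bnd fl f0 gs.
have := section_bound fl f0 gs.
rewrite /graph_transform.
set x := graph_point _ _ _ _ _ in gs gE ys *.
set y := f (u m) x in gE ys * => yb.
have y0 : `|0 : Y (u m)| < s by rewrite normr0; apply: le_lt_trans ys.
have := hyp_F FG (lt_r s0) ys y0; rewrite -gE subr0 => xF.
have := hyp_G FG (lt_r s0) ys y0; rewrite subr0 => yG.
have xb : `|x| <= eta (u m) + a m * `|y|.
  by have := ler_distD (F m 0 0) x 0; have := F00 m; rewrite !subr0; lra.
have gb : `|G m 0 y| <= eta m + lu m * `|y|.
  by have := ler_distD (G m 0 0) (G m 0 y) 0; have := G00 m; rewrite !subr0; lra.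
have /andP[b1 b2] := hyp_beta FG m.
have b0 := hyp_beta' FG (u m).
have /andP[e0 _] := eta_bnd m; have /andP[eu0 _] := eta_bnd (u m).
have lu0 := hyp_lu FG m; have /andP[ls0 _] := hyp_ls FG m.
have K0 := adm_K adm.
have d0 : 0 < 1 - a m * beta' (u m) by have := hyp_gap FG m; lra.
have yd : `|y| * (1 - a m * beta' (u m)) <= (K + B) * eta (u m).
  have : beta' (u m) * `|x| <= beta' (u m) * (eta (u m) + a m * `|y|).
    exact: ler_wpM2l.
  have : beta' (u m) * eta (u m) <= B * eta (u m) by apply: ler_wpM2r => //; lra.
  lra.
have lub : lu m * `|y| <= (K + B) * th * eta m.
  rewrite -(ler_pM2r d0).
  have h1 : lu m * (`|y| * (1 - a m * beta' (u m))) <= lu m * ((K + B) * eta (u m)).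
    exact: ler_wpM2l.
  have KB0 : 0 <= K + B by lra.
  have h2 : lu m * (K + B) * eta (u m) <= lu m * (K + B) * (eps1 m * eta m).
    by apply: ler_wpM2l => //; exact: mulr_ge0.
  have h3 : (K + B) * eta m * (lu m * eps1 m) <=
      (K + B) * eta m * (th * (1 - a m * beta' (u m))).
    apply: ler_wpM2l; first exact: mulr_ge0.
    by apply: le_trans (gap m); rewrite lerDr mulr_ge0.
  lra.
have : (1 + th * B) * eta m <= (1 - th) * K * eta m by exact: ler_wpM2r.
lra.
Qed.

Lemma picard_small_lip (th : R) (eps1 : M -> R) :
  (forall m, `|G m 0 0| <= eta m) -> 0 <= th -> 1 + th * B <= (1 - th) * K ->
  (forall m, 0 <= eps1 m) -> (forall m, eta (u m) <= eps1 m * eta m) ->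
  (forall m, lu m * ls m + lu m * eps1 m <= th * (1 - a m * beta' (u m))) ->
  forall n, small_at0 K eta (picard sigma F G n).
Proof.
move=> G00 th0 KB eps0 etau gap n.
suff : lip_on sigma beta' (picard sigma F G n) /\
    small_at0 K eta (picard sigma F G n) by case.
elim: n => [|n [IHl IHs]].
  split=> [m x x' _ _|m].
    by rewrite subrr normr0 mulr_ge0 // (hyp_beta' FG).
  by rewrite normr0 mulr_ge0 //; [exact: adm_K adm | case/andP: (eta_bnd m)].
split; first exact (graph_transform_lip FG adm eta_bnd F00 IHl IHs).
exact: graph_transform_small G00 th0 KB eps0 etau gap IHl IHs.
Qed.

End Existence.

(** * Bound at the origin under the cone condition (A) *)

Section ConeSmall.
Context {r s A B lam : R} {a beta beta' lu ls : M -> R} {F G}.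
Arguments F : clear implicits.
Arguments G : clear implicits.
Context {sigma eta0 K : R} {eta : M -> R}.
Hypothesis FG : hyperbolic r s A B lam a beta beta' lu ls F G.
Hypothesis adm : admissible r s A B lam sigma eta0 K.
Hypothesis eta_bnd : forall m, 0 <= eta m <= eta0.
Hypothesis F00 : forall m, `|F m 0 0| <= eta (u m).
Hypothesis G00 : forall m, `|G m 0 0| <= eta m.
Context {alpha eps1 : M -> R} {th : R}.
Hypothesis HA : coneA r s alpha a lu F G.
Hypothesis alpha_ge0 : forall m, 0 <= alpha m.
Hypothesis a_alpha : forall m, a m <= alpha (u m).
Hypothesis th_ge0 : 0 <= th.
Hypothesis KB : 2 + B + th * B <= (1 - th) * K.
Hypothesis eta_u : forall m, eta (u m) <= eps1 m * eta m.
Hypothesis lu_eps : forall m, lu m * eps1 m <= th.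

Let lt_r (m : M) (x : X m) : `|x| < sigma -> `|x| < r.
Proof. by move=> /lt_le_trans; apply; exact: adm_sigma_r adm. Qed.

Let F' m x y := F m x y - F m 0 0.
Let G' m x y := G m x y - G m 0 0.
Arguments F' : clear implicits.
Arguments G' : clear implicits.

Let cancel_shift {V : normedModType R} (x y z : V) : (x - z) - (y - z) = x - y.
Proof. by rewrite opprB addrA subrK. Qed.

Lemma hyperbolic_shift : hyperbolic r s A B lam a beta beta' lu ls F' G'.
Proof.
case: FG => *; split => //.
- by move=> *; rewrite /F' cancel_shift; auto.
- by move=> *; rewrite /G' cancel_shift; auto.
- by move=> m x x' y y' ? ? ? ?; rewrite /F' /G' !cancel_shift; auto.
Qed.

Let zero_bnd (m : M) : 0 <= (0 : R) <= eta0.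
Proof. by rewrite lexx; case/andP: (eta_bnd m) => /le_trans; apply. Qed.

Let F'00 m : `|F' m 0 0| <= 0.
Proof. by rewrite /F' subrr normr0. Qed.

(* Pulling [p] towards [x] by an amount comparable to [eta m] absorbs the translation by [(F m 0 0, G m 0 0)]
   between the two systems, so the cone relation persists without losing a constant factor at each step. *)
Definition cone_close f g := forall m (x p : X m) c,
  `|x| < sigma -> `|p| < sigma -> 0 <= c <= alpha m -> c * beta' m <= 1 / 2 ->
  `|x - p| <= c * (`|f m x - g m p| + B * eta m) -> `|f m x - g m p| <= K * eta m.

(** The pulled point [z] and [x] satisfy the cone hypothesis of [HA]. The image [F m z w] is [z2]
    shifted by [F m 0 0] and becomes the next [p]; the term [B * eta] in [cone_close] pays for
    evaluating [g] there instead of at [z2]. *)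
Lemma cone_close_step f g : lip_on sigma beta' f -> small_at0 K eta f ->
  lip_on sigma beta' g -> small_at0 K (fun=> 0) g -> cone_close f g ->
  cone_close (graph_transform sigma F G f) (graph_transform sigma F' G' g).
Proof.
move=> fl f0 gl g0 close m x p c xs ps /andP[c0 calpha] cb xp.
have FG' := hyperbolic_shift.
have [xs2 xE2] := graph_pointP FG adm eta_bnd F00 fl f0 xs.
have ys2 := section_in FG adm eta_bnd fl f0 xs2.
have b0 := hyp_beta' FG m; have bu0 := hyp_beta' FG (u m).
have /andP[e0 e1] := eta_bnd m; have /andP[eu0 eu1] := eta_bnd (u m).
have /andP[bb bB] := hyp_beta FG m.
have B0 : 0 <= B by lra.
have K0 := adm_K adm; have lu0 := hyp_lu FG m.
set D := `|graph_transform sigma F G f m x - _| in xp *.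
have [D_small|D_big] := leP D ((2 + B) * eta m).
  apply: le_trans D_small _; apply: ler_wpM2r => //.
  have : 0 <= th * B by exact: mulr_ge0.
  have : 0 <= th * K by exact: mulr_ge0.
  move: KB; lra.
have L0 : 0 < D + B * eta m.
  have : 0 <= B * eta m by exact: mulr_ge0.
  have : (2 + B) * eta m >= 0 by apply: mulr_ge0 => //; lra.
  lra.
set L := D + B * eta m in xp L0.
(* This [q] makes [(1 - q) * L] equal to [D - (2 + B) * eta m], the lower bound of [DG]; [q <= 1]
   because [D] exceeds [(2 + B) * eta m]. *)
pose q := 2 * (1 + B) * eta m / L.
have qL : q * L = 2 * (1 + B) * eta m by rewrite /q divfK // gt_eqF.
have q0 : 0 <= q.
  by rewrite divr_ge0 ?(ltW L0) // mulr_ge0 // mulr_ge0 //; lra.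
have q1 : q <= 1 by rewrite ler_pdivrMr // /L; lra.
clearbody q.
pose z := p + q *: (x - p).
have xz : `|x - z| = (1 - q) * `|x - p|.
  rewrite /z opprD addrA -{1}[x - p]scale1r -scalerBl normrZ ger0_norm //; lra.
have zp : `|z - p| = q * `|x - p|.
  by rewrite /z addrAC subrr add0r normrZ ger0_norm.
have zs : `|z| < sigma.
  have -> : z = (1 - q) *: p + q *: x.
    by rewrite /z scalerBr scalerBl scale1r addrAC addrA addrAC.
  apply: le_lt_trans (ler_normD _ _) _; rewrite !normrZ !ger0_norm //; last by lra.
  have [xp_le|px_le] := leP `|x| `|p|.
    have : q * `|x| <= q * `|p| by exact: ler_wpM2l.
    lra.
  have : (1 - q) * `|p| <= (1 - q) * `|x| by rewrite ler_wpM2l ?subr_ge0 // ltW.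
  lra.
have [zs2 zE2] := graph_pointP FG' adm zero_bnd F'00 gl g0 zs.
have ws2 := section_in FG' adm zero_bnd gl g0 zs2.
have zplip := graph_transform_lip FG' adm zero_bnd F'00 gl g0 zs ps.
have zb := graph_point_bound FG' adm zero_bnd F'00 gl g0 zs.
set P := graph_transform sigma F' G' g m p in zplip.
have DE : D = `|graph_transform sigma F G f m x - P| by [].
rewrite /graph_transform in DE zplip.
set x2 := graph_point _ _ _ _ _ in xs2 xE2 ys2 DE.
set z2 := graph_point _ _ _ _ _ in zs2 zE2 ws2 zb zplip.
set y := f (u m) x2 in xE2 ys2 DE *; set w := g (u m) z2 in zE2 ws2 zplip *.
(* Moving [p] to [z] changes the transform of [g] by at most [c * beta' m * (q * L)], hence by at
   most half of [q * L]. *)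
have zP : `|G' m z w - P| <= (1 + B) * eta m.
  apply: le_trans zplip _; rewrite zp.
  have : beta' m * (q * `|x - p|) <= beta' m * (q * (c * L)).
    by rewrite ler_wpM2l // ler_wpM2l.
  have : c * beta' m * (q * L) <= 1 / 2 * (q * L).
    by rewrite ler_wpM2r // qL mulr_ge0 // mulr_ge0 //; lra.
  lra.
have DG : D - (2 + B) * eta m <= `|G m x y - G m z w|.
  have := ler_distD (G m z w) (G m x y) P.
  have : `|G m z w - P| <= `|G' m z w - P| + eta m.
    have -> : G m z w - P = (G' m z w - P) + G m 0 0 by rewrite addrAC subrK.
    by apply: le_trans (ler_normD _ _) _; rewrite lerD2l.
  rewrite DE; lra.
have cone : `|x - z| <= alpha m * `|G m x y - G m z w|.
  have : (1 - q) * `|x - p| <= (1 - q) * (c * L) by rewrite ler_wpM2l ?subr_ge0.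
  have : c * (D - (2 + B) * eta m) <= alpha m * `|G m x y - G m z w|.
    by apply: ler_pM => //; lra.
  have : c * (q * L) = c * (2 * (1 + B) * eta m) by rewrite qL.
  rewrite xz /L; lra.
have [] := HA (lt_r xs) (lt_r zs) ys2 ws2 cone; rewrite -xE2 => xcone ycone.
pose p2 := F m z w.
have p2E : p2 = z2 + F m 0 0 by rewrite zE2 /F' subrK.
have p2s : `|p2| < sigma.
  have := ler_normD z2 (F m 0 0); rewrite -p2E.
  have /andP[ls0 lsl] := hyp_ls FG m; have lam1 := hyp_lam FG.
  have : ls m * `|z| <= lam * sigma by apply: ler_pM => //; exact: ltW.
  have : 0 < (1 - lam) * sigma by rewrite mulr_gt0 ?subr_gt0 // (adm_sigma adm).
  have : 0 <= A * K * eta0.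
    by rewrite mulr_ge0 // ?mulr_ge0 ?(adm_A adm) //; apply: le_trans e1.
  have := adm_etaK adm; have := F00 m; move: zb; lra.
have gp2 : `|g (u m) p2 - w| <= B * eta (u m).
  have := gl _ _ _ p2s zs2; rewrite -/w p2E addrAC subrr add0r => /le_trans; apply.
  by apply: ler_pM => //; lra.
have yw : `|y - w| <= `|y - g (u m) p2| + B * eta (u m).
  by have := ler_distD (g (u m) p2) y w; lra.
have /andP[a0 aA] := hyp_a FG m.
(* Here [a m] is the cone constant at [u m]. This is why [cone_close] leaves [c] free: the gap
   controls [a m * beta' (u m)], but not [alpha (u m) * beta' (u m)]. *)
have close2 : `|y - g (u m) p2| <= K * eta (u m).
  apply: (close _ _ _ (a m)) => //; first by rewrite a0 a_alpha.
    exact: hyp_gap FG m.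
  by apply: le_trans xcone _; exact: ler_wpM2l.
have : lu m * `|y - w| <= lu m * ((K + B) * eta (u m)).
  by rewrite ler_wpM2l //; lra.
have : lu m * (K + B) * eta (u m) <= lu m * (K + B) * (eps1 m * eta m).
  by rewrite ler_wpM2l // mulr_ge0 //; lra.
have : (K + B) * eta m * (lu m * eps1 m) <= (K + B) * eta m * th.
  by rewrite ler_wpM2l // mulr_ge0 //; lra.
have : (2 + B + th * B) * eta m <= (1 - th) * K * eta m by rewrite ler_wpM2r.
move: DG ycone; lra.
Qed.

Lemma picard_small_cone n : small_at0 K eta (picard sigma F G n).
Proof.
have FG' := hyperbolic_shift; have K0 := adm_K adm.
pose f n := picard sigma F G n; pose g n := picard sigma F' G' n.
suff H k : [/\ lip_on sigma beta' (f k), small_at0 K eta (f k),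
    lip_on sigma beta' (g k), small_at0 K (fun=> 0) (g k) & cone_close (f k) (g k)].
  by case: (H n).
have lip0 : lip_on sigma beta' (fun m (_ : X m) => 0 : Y m).
  by move=> m x x' _ _; rewrite subrr normr0 mulr_ge0 // (hyp_beta' FG).
elim: k => [|k [fl f0 gl g0 close]].
  split => // m; rewrite ?normr0 ?mulr_ge0 //; try by case/andP: (eta_bnd m).
  move=> x p c _ _ _ _ _; rewrite subrr normr0 mulr_ge0 //.
  by case/andP: (eta_bnd m).
have close' := cone_close_step fl f0 gl g0 close.
have g0' : small_at0 K (fun=> 0) (g k.+1).
  move=> m; rewrite -[g k.+1]/(graph_transform sigma F' G' (g k)).
  rewrite mulr0 normr_le0 /graph_transform.
  have := graph_point0_bound FG' adm zero_bnd F'00 gl g0 m.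
  rewrite mulr0 normr_le0 => /eqP ->.
  have := g0 (u m); rewrite mulr0 normr_le0 => /eqP ->.
  by rewrite /G' subrr.
split => //.
- exact (graph_transform_lip FG adm eta_bnd F00 fl f0).
- move=> m; have s0 : `|0 : X m| < sigma by rewrite normr0 (adm_sigma adm).
  have := g0' m; rewrite mulr0 normr_le0 => /eqP g00.
  have : `|f k.+1 m 0 - g k.+1 m 0| <= K * eta m; last by rewrite g00 subr0.
  (* At [x = p = 0] with [c = 0] the cone relation is trivial; as the translated iterate vanishes at
     [0], closeness is the required bound. *)
  apply: (close' m 0 0 0 s0 s0).
  + by rewrite lexx alpha_ge0.
  + by rewrite mul0r; lra.
  + by rewrite subr0 normr0 mul0r.
- exact (graph_transform_lip FG' adm zero_bnd F'00 gl g0).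
Qed.

End ConeSmall.

End GraphTransform.
Arguments graph_point {R M X Y u} sigma F f m x.
Arguments graph_transform {R M X Y u} sigma F G f m x.
Arguments picard {R M X Y u} sigma F G n m x.

(** * Uniform constants from suprema *)

Lemma supf_bound {R : realType} {M : Type} (a : M -> R) (c : \bar R) :
  (0 < c)%E -> (supf a < c)%E ->
  exists t : R, [/\ 0 <= t, (t%:E < c)%E & forall m, a m <= t].
Proof.
(* The maximum with [0] makes [t] nonnegative and covers an empty [M], where the supremum is
   [-oo]. *)
move=> c0 ac; pose t := fine (Order.max 0 (supf a))%E.
have maxfin : (Order.max 0 (supf a))%E \is a fin_num.
  rewrite fin_numE; apply/andP; split.
    by rewrite gt_eqF // (lt_le_trans (ltNyr 0)) // le_max lexx.
  by rewrite lt_eqF // (@lt_le_trans _ _ c) ?leey // gt_max c0.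
have tE : t%:E = Order.max 0%E (supf a) by rewrite fineK.
exists t; split.
- by rewrite -lee_fin tE le_max lexx.
- by rewrite tE gt_max c0.
- move=> m; rewrite -lee_fin tE le_max; apply/orP; right.
  by apply: ereal_sup_ubound; exists m.
Qed.

Lemma admissible_exists {R : realType} (r s A B lam K : R) : 0 < r -> 0 < s ->
  0 <= A -> 0 <= B -> 0 <= K -> lam < 1 ->
  exists2 s1 : R, 0 < s1 & forall sigma, 0 < sigma <= s1 ->
    exists2 e : R, 0 < e & forall eta0, eta0 <= e ->
      admissible r s A B lam sigma eta0 K.
Proof.
move=> r0 s0 A0 B0 K0 lam1.
have B1 : 0 < 2 * (B + 1) by lra.
(* The second bound gives [B * sigma < s / 2]; the choice of [e] below likewise gives
   [K * eta0 <= s / 2]. *)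
exists (Num.min r (s / (2 * (B + 1)))); first by rewrite lt_min r0 divr_gt0.
move=> sigma /andP[sg0]; rewrite le_min => /andP[sgr].
rewrite ler_pdivlMr // => sgs.
have AK : 0 < 6 * (1 + A * K) by rewrite mulr_gt0 // ltr_pwDl // mulr_ge0.
have K1 : 0 < 2 * (K + 1) by lra.
exists (Num.min ((1 - lam) * sigma / (6 * (1 + A * K))) (s / (2 * (K + 1)))).
  by rewrite lt_min !divr_gt0 // mulr_gt0 // subr_gt0.
move=> eta0; rewrite le_min; rewrite !ler_pdivlMr // => /andP[e1 e2].
split => //; first lra.
have [eK|eK] := leP 0 eta0; first lra.
have : K * eta0 <= 0 by rewrite mulr_ge0_le0 // ltW.
lra.
Qed.

Definition robust_solution {R : realType} {M : Type}
    {X Y : M -> completeNormedModType R} {u : M -> M}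
    (H : forall m, set ((X m * Y m) * (X (u m) * Y (u m))))
    (sigma eta0 : R) (eps1 beta' ls eta : M -> R) : Prop :=
  exists f : forall m, X m -> Y m,
    unique_solution sigma H beta' ls eta f /\
    (forall eta' eps' : M -> R,
       nonneg eta' ->
       (forall m, [/\ eta' (u m) <= eps' m * eta' m, eps' m <= eps1 m
                    & eta m <= eta' m <= eta0]) ->
       unique_solution sigma H beta' ls eta' f).

(** * From generating maps back to correspondences *)

Section Correspondence.
Context {R : realType} {M : Type} {X Y : M -> completeNormedModType R}.
Context {u : M -> M} {r1 r1' r2 r2' : R}.
Context {H : forall m, set ((X m * Y m) * (X (u m) * Y (u m)))}.
Arguments H : clear implicits.
Context {F : forall m, X m -> Y (u m) -> X (u m)}.
Context {G : forall m, X m -> Y (u m) -> Y m}.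
Arguments F : clear implicits.
Arguments G : clear implicits.
Hypothesis HFG : hyp_corr r1 r1' r2 r2' H F G.

Lemma corr_mem m x y : `|x| < r1 -> `|y| < r2' ->
  H m ((x, G m x y), (F m x y, y)).
Proof.
move=> xr yr; have [_ [Fr Gr gen]] := HFG m.
by apply/(gen _ _ _ _ xr (Gr _ _ xr yr) (Fr _ _ xr yr) yr).
Qed.

Lemma corr_memE m x1 y1 x2 y2 : H m ((x1, y1), (x2, y2)) ->
  [/\ `|x1| < r1, `|y2| < r2', y1 = G m x1 y2 & x2 = F m x1 y2].
Proof.
move=> h; have [[_ sub] [Fr Gr gen]] := HFG m.
have [[/= x1r y1r] [/= x2r y2r]] := sub _ h.
by have [-> ->] := (gen _ _ _ _ x1r y1r x2r y2r).1 h.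
Qed.

Lemma condB_generating (beta beta' ls : M -> R) :
  (forall m, condB (H m) (beta m) (beta' m) (ls m)) ->
  forall m (x x' : X m) (y y' : Y (u m)),
    `|x| < r1 -> `|x'| < r1 -> `|y| < r2' -> `|y'| < r2' ->
    `|y - y'| <= beta m * `|F m x y - F m x' y'| ->
    `|G m x y - G m x' y'| <= beta' m * `|x - x'| /\
    `|F m x y - F m x' y'| <= ls m * `|x - x'|.
Proof.
by move=> HB m x x' y y' xr x'r yr y'r; apply: HB; exact: corr_mem.
Qed.

Lemma condA_generating (alpha a lu : M -> R) :
  (forall m, condA (H m) (alpha m) (a m) (lu m)) -> coneA r1 r2' alpha a lu F G.
Proof.
by move=> HA m x x' y y' xr x'r yr y'r; apply: HA; exact: corr_mem.
Qed.

(** The map [xi] of the solution supplies the points [x']. The constants may be enlarged freely so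
    that two solutions can share them. *)
Lemma solution_chain (sigma : R) (beta' ls eta : M -> R) f : (forall m, 0 <= eta m) ->
  solution sigma H beta' ls eta f ->
  exists K K0 : R, [/\ 0 <= K, 0 <= K0 & forall K' K0', K <= K' -> K0 <= K0' ->
    is_chain r2' sigma K' K0' beta' ls eta F G (fun=> f)].
Proof.
move=> eta0 [[fl [K K_ge0 fK]] [_ [xi [K0 xiP]]]].
exists K, (Num.max 0 K0); split => //; first by rewrite le_max lexx.
move=> K' K0' KK'; rewrite ge_max => /andP[K0'_ge0 K0K0'] _.
split; first by move=> m x x' xs x's; exact: (fl m (x, x') (conj xs x's)).
  by move=> m; apply: le_trans (fK m) _; exact: ler_wpM2r.
move=> m x xs; have [xis /(_ _ xs)/corr_memE[_ ys fE xiE] xil xi0] := xiP m.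
exists (xi m x); split => //; first exact: xis.
have s0 : oball (X m) sigma 0 by rewrite /oball /= normr0; apply: le_lt_trans xs.
have /= := xil (x, 0) (conj xs s0); rewrite subr0.
have := ler_distD (xi m 0) (xi m x) 0; rewrite !subr0.
have : K0 * eta (u m) <= K0' * eta (u m) by exact: ler_wpM2r.
by move: xi0; lra.
Qed.

(** Constant chains have a difference independent of [n], yet merging bounds it by [C * t ^+ n], so
    it vanishes. *)
Lemma solution_unique (sigma : R) (beta' ls eta : M -> R) f g :
  (forall m, 0 <= eta m) -> chains_merge r2' sigma beta' ls eta F G ->
  solution sigma H beta' ls eta f -> solution sigma H beta' ls eta g ->
  agree sigma g f.
Proof.
move=> eta0 merge /(solution_chain eta0)[K [K0 [K_ge0 K0_ge0 fc]]].
move=> /(solution_chain eta0)[L [L0 [L_ge0 L0_ge0 gc]]].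
have {}fc : is_chain r2' sigma (K + L) (K0 + L0) beta' ls eta F G (fun=> f).
  by apply: fc; rewrite lerDl.
have {}gc : is_chain r2' sigma (K + L) (K0 + L0) beta' ls eta F G (fun=> g).
  by apply: gc; rewrite lerDr.
have [t t01 rate] :=
  merge _ _ _ _ (addr_ge0 K_ge0 L_ge0) (addr_ge0 K0_ge0 L0_ge0) gc fc.
move=> m x /(rate m x)[C HC].
apply/eqP; rewrite -subr_eq0 -normr_le0.
by apply: (@le_geometric _ _ _ C t) => // n; rewrite add0r; exact: HC.
Qed.

(** Enlarging [eta] to [eta'] only weakens the bounds at [0], so the [f] built from [eta] remains a
    solution, and merging for [eta'] makes it the only one. *)
Lemma solution_exists (A B lam sigma eta0 K : R) (eps1 a beta beta' lu ls eta : M -> R) :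
  hyperbolic r1 r2' A B lam a beta beta' lu ls F G ->
  admissible r1 r2' A B lam sigma eta0 K ->
  (forall m, 0 <= eps1 m) ->
  (forall m, 0 <= eta m <= eta0) -> (forall m, eta (u m) <= eps1 m * eta m) ->
  (forall m, `|F m 0 0| <= eta (u m)) ->
  (forall n, small_at0 K eta (picard sigma F G n)) ->
  (forall eta' : M -> R, (forall m, 0 <= eta' m) ->
     (forall m, eta' (u m) <= eps1 m * eta' m) ->
     chains_merge r2' sigma beta' ls eta' F G) ->
  robust_solution H sigma eta0 eps1 beta' ls eta.
Proof.
move=> FG adm eps0 eta_bnd eta_u F00 small merge.
have eta_ge0 m : 0 <= eta m by case/andP: (eta_bnd m).
have [f [fl f0 fE]] :=
  invariant_section_exists FG adm eta_bnd F00 small (merge _ eta_ge0 eta_u).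
have K_ge0 := adm_K adm.
have K0_ge0 : 0 <= 2 * (1 + A * K).
  by rewrite mulr_ge0 // addr_ge0 // mulr_ge0 // (adm_A adm).
have sol (eta' : M -> R) : (forall m, 0 <= eta' m) -> (forall m, eta m <= eta' m) ->
    solution sigma H beta' ls eta' f.
  move=> eta'_ge0 eta_le.
  have gp m (x : X m) (xs : `|x| < sigma) := graph_pointP FG adm eta_bnd F00 fl f0 xs.
  have mem m (x : X m) : `|x| < sigma -> H m ((x, f m x),
      (graph_point sigma F f m x, f (u m) (graph_point sigma F f m x))).
    move=> xs; have [gs gE] := gp m x xs; rewrite [f m x]fE // /graph_transform.
    have xr : `|x| < r1 by apply: lt_le_trans xs (adm_sigma_r adm).
    have := corr_mem xr (section_in FG adm eta_bnd fl f0 gs).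
    by rewrite -gE.
  split; [split|split].
  - by move=> m [x x'] [/= xs x's]; exact: fl.
  - by exists K => // m; apply: le_trans (f0 m) _; exact: ler_wpM2l.
  - move=> m [x y] [/= xs ->].
    exists (graph_point sigma F f m x, f (u m) (graph_point sigma F f m x)).
      by split => //=; case: (gp m x xs).
    exact: mem.
  - exists (graph_point sigma F f), (2 * (1 + A * K)) => m; split.
    + by move=> x xs; case: (gp m x xs).
    + exact: mem.
    + move=> [x x'] [/= xs x's].
      exact (graph_point_lip FG adm eta_bnd F00 fl f0 xs x's).
    + apply: le_trans (ler_wpM2l K0_ge0 (eta_le (u m))).
      exact (graph_point0_bound FG adm eta_bnd F00 fl f0 m).
exists f; split.
  have fs := sol _ eta_ge0 (fun=> lexx _); split => // g.
  exact: solution_unique (merge _ eta_ge0 eta_u) fs.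
move=> eta' eps' eta'_ge0 eta'P.
have eta_le m : eta m <= eta' m by case: (eta'P m) => _ _ /andP[].
have eta'_u m : eta' (u m) <= eps1 m * eta' m.
  by case: (eta'P m) => h1 h2 _; apply: le_trans h1 _; exact: ler_wpM2r.
have fs := sol _ eta'_ge0 eta_le; split => // g.
exact: solution_unique (merge _ eta'_ge0 eta'_u) fs.
Qed.

End Correspondence.

(** * The two alternative sets of hypotheses *)

Section Cases.
Context {R : realType} {M : Type} {X Y : M -> completeNormedModType R}.
Context {u : M -> M} {r1 r1' r2 r2' : R}.
Context {eps1 alpha alpha' beta beta' lu ls : M -> R}.
Hypothesis r1_gt0 : 0 < r1.
Hypothesis r2'_gt0 : 0 < r2'.
Hypothesis eps1_ge0 : nonneg eps1.
Hypothesis alpha_ge0 : nonneg alpha.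
Hypothesis alpha'_ge0 : nonneg alpha'.
Hypothesis beta'_ge0 : nonneg beta'.
Hypothesis lu_ge0 : nonneg lu.
Hypothesis ls_ge0 : nonneg ls.

(** The constants are fixed before [H], [F], [G] and [eta], and every smaller [sigma] is allowed, so
    that both cases can share one radius. *)
Definition solvable_under
    (P : (forall m, set ((X m * Y m) * (X (u m) * Y (u m)))) ->
         (forall m, X m -> Y (u m) -> X (u m)) ->
         (forall m, X m -> Y (u m) -> Y m) -> Prop) : Prop :=
  exists2 s1 : R, 0 < s1 & forall sigma, 0 < sigma <= s1 ->
  exists2 e : R, 0 < e & forall eta0, eta0 <= e -> forall H F G eta,
    hyp_corr r1 r1' r2 r2' H F G -> P H F G ->
    hyp_i F G eps1 eta -> (supf eta <= eta0%:E)%E ->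
    robust_solution H sigma eta0 eps1 beta' ls eta.

Let hyp_i_bounds {F G eta eta0} : @hyp_i R M X Y u F G eps1 eta ->
  (supf eta <= eta0%:E)%E ->
  [/\ forall m, 0 <= eta m <= eta0, forall m, eta (u m) <= eps1 m * eta m,
      forall m, `|F m 0 0| <= eta (u m) & forall m, `|G m 0 0| <= eta m].
Proof.
move=> [FG0 eta_ge0 [eps epsP]] sup_eta; split => m.
- rewrite eta_ge0 -lee_fin (le_trans _ sup_eta) //.
  by apply: ereal_sup_ubound; exists m.
- have [h /andP[_ h']] := epsP m.
  by apply: le_trans h _; apply: ler_wpM2r => //; exact: eta_ge0.
- by case: (FG0 m).
- by case: (FG0 m).
Qed.

Lemma solvable_lip : solvable_under (fun H F G =>
  hyp_ii r1 r2' H F G eps1 alpha beta beta' lu ls).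
Proof.
(* The constants must precede [H], [F], [G], but the bounds on the coefficients mention none of
   them: one instance suffices to extract these bounds, and if there is none the claim is
   vacuous. *)
have [[H0 [F0 [G0 ex]]]|no] := pselect (exists H F G,
    @hyp_ii R M X Y u r1 r2' H F G eps1 alpha beta beta' lu ls); last first.
  by exists 1 => // sigma _; exists 1 => // *; exfalso; apply: no; do 3 eexists; eauto.
case: ex => _ [gap bb sup_ab] [sup_th sup_ls] {H0 F0 G0}.
have [|k [_]] := supf_bound _ gap; first by rewrite lte_fin; lra.
rewrite lte_fin => k_lt gapP.
have {}gap m : alpha m * beta' (u m) <= 1 / 2 by have := gapP m; lra.
have [//|T [T0 _ TP]] := supf_bound _ sup_ab.
have {}TP m : alpha m <= T /\ beta m <= T by have := TP m; rewrite ge_max => /andP.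
have [|th [th0]] := supf_bound _ sup_th; first by rewrite lte_fin.
rewrite lte_fin => th1 thP.
have [|lam [lam0]] := supf_bound _ sup_ls; first by rewrite lte_fin.
rewrite lte_fin => lam1 lamP.
have {}thP m : lu m * ls m + lu m * eps1 m <= th * (1 - alpha m * beta' (u m)).
  by rewrite -ler_pdivrMr //; have := gap m; lra.
(* The least value that [picard_small_lip] admits when [B] is [T]. *)
pose K := (1 + th * T) / (1 - th).
have KE : (1 - th) * K = 1 + th * T by rewrite /K mulrC divfK // gt_eqF // subr_gt0.
have K0 : 0 <= K.
  by apply: divr_ge0; [rewrite !addr_ge0 // mulr_ge0 | rewrite subr_ge0 ltW].
have [s1 s1_gt0 sP] := admissible_exists r1_gt0 r2'_gt0 T0 T0 K0 lam1.
exists s1 => // sigma /sP[e e_gt0 eP]; exists e => // eta0 /eP adm H F G eta HFG.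
move=> [AB _ _] hi sup_eta.
have [eta_bnd eta_u F00 G00] := hyp_i_bounds hi sup_eta.
have FG : hyperbolic r1 r2' T T lam alpha beta beta' lu ls F G.
  split => //.
  - by move=> m; rewrite alpha_ge0; case: (TP m).
  - by move=> m; rewrite bb; case: (TP m).
  - by move=> m; rewrite ls_ge0 lamP.
  - move=> m x y y' xr yr y'r; case: (AB m) => /(_ x xr)[h _] _.
    exact: (h (y, y') (conj yr y'r)).
  - move=> m x y y' xr yr y'r; case: (AB m) => /(_ x xr)[_ h] _.
    exact: (h (y, y') (conj yr y'r)).
  - by apply: condB_generating => // m; case: (AB m).
apply: (solution_exists HFG FG adm) => //.
  by apply: (picard_small_lip FG adm eta_bnd F00 G00 th0) => //; rewrite KE.
move=> eta' eta'_ge0 eta'_u.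
apply: (chains_merge_lip FG (adm_sigma_r adm) _ eta'_ge0 eta'_u eps1_ge0 thP).
by rewrite th0.
Qed.

Lemma solvable_cone : solvable_under (fun H F G =>
  hyp_ii' H eps1 alpha alpha' beta beta' lu ls).
Proof.
have [[H0 ex]|no] := pselect (exists H,
    @hyp_ii' R M X Y u H eps1 alpha alpha' beta beta' lu ls); last first.
  by exists 1 => // sigma _; exists 1 => // *; exfalso; apply: no; eexists; eauto.
case: ex => _ [gap aa bb sup_ab] [sup_th1 sup_th2 sup_ls] {H0}.
have [|k [_]] := supf_bound _ gap; first by rewrite lte_fin; lra.
rewrite lte_fin => k_lt gapP.
have {}gap m : alpha' m * beta' (u m) <= 1 / 2 by have := gapP m; lra.
have [//|T [T0 _ TP]] := supf_bound _ sup_ab.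
have {}TP m : alpha m <= T /\ beta m <= T by have := TP m; rewrite ge_max => /andP.
have [|t1 [t10]] := supf_bound _ sup_th1; first by rewrite lte_fin.
rewrite lte_fin => t11 t1P.
have [|t2 [t20]] := supf_bound _ sup_th2; first by rewrite lte_fin.
rewrite lte_fin => t21 t2P.
have [|lam [lam0]] := supf_bound _ sup_ls; first by rewrite lte_fin.
rewrite lte_fin => lam1 lamP.
(* [weight_decay] needs a single rate for [lu m * ls m] and [lu m * eps1 m]. *)
pose th := Num.max t1 t2.
have th0 : 0 <= th by rewrite le_max t10.
have th1 : th < 1 by rewrite gt_max t11.
have luls m : lu m * ls m <= th by rewrite mulrC le_max t1P.
have lueps m : lu m * eps1 m <= th by rewrite le_max t2P orbT.
pose K := (2 + T + th * T) / (1 - th).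
have KE : (1 - th) * K = 2 + T + th * T by rewrite /K mulrC divfK // gt_eqF // subr_gt0.
have K0 : 0 <= K.
  by apply: divr_ge0; [rewrite !addr_ge0 // mulr_ge0 | rewrite subr_ge0 ltW].
have [s1 s1_gt0 sP] := admissible_exists r1_gt0 r2'_gt0 T0 T0 K0 lam1.
exists s1 => // sigma /sP[e e_gt0 eP]; exists e => // eta0 /eP adm H F G eta HFG.
move=> [AB _ _] hi sup_eta.
have [eta_bnd eta_u F00 G00] := hyp_i_bounds hi sup_eta.
have HA : coneA r1 r2' alpha alpha' lu F G.
  by apply: (condA_generating HFG) => m; case: (AB m).
have FG : hyperbolic r1 r2' T T lam alpha' beta beta' lu ls F G.
  split => //.
  - by move=> m; rewrite alpha'_ge0 (le_trans (aa m)) //; case: (TP (u m)).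
  - by move=> m; rewrite bb; case: (TP m).
  - by move=> m; rewrite ls_ge0 lamP.
  - move=> m x y y' xr yr y'r.
    by case: (HA m x x y y' xr xr yr y'r) => //; rewrite subrr normr0 mulr_ge0.
  - move=> m x y y' xr yr y'r.
    by case: (HA m x x y y' xr xr yr y'r) => //; rewrite subrr normr0 mulr_ge0.
  - by apply: condB_generating => // m; case: (AB m).
apply: (solution_exists HFG FG adm) => //.
  apply: (picard_small_cone FG adm eta_bnd F00 G00 HA alpha_ge0 aa th0 _ eta_u lueps).
  by rewrite KE.
move=> eta' eta'_ge0 eta'_u.
apply: (chains_merge_cone FG (adm_sigma_r adm) _ eta'_ge0 eta'_u HA) => //.
by rewrite th0.
Qed.

End Cases.

Theorem theorem4p6 (R : realType) (M : Type) (X Y : M -> completeNormedModType R)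
    (u : M -> M) (r1 r1' r2 r2' : R)
    (eps1 alpha alpha' beta beta' lu ls : M -> R)
    (r1_gt0 : 0 < r1) (r1'_gt0 : 0 < r1') (r2_gt0 : 0 < r2) (r2'_gt0 : 0 < r2')
    (eps1_ge0 : nonneg eps1) (alpha_ge0 : nonneg alpha)
    (alpha'_ge0 : nonneg alpha') (beta_ge0 : nonneg beta)
    (beta'_ge0 : nonneg beta') (lu_ge0 : nonneg lu) (ls_ge0 : nonneg ls) :
  forall delta : R, 0 < delta ->
  exists2 eta_max : R, 0 < eta_max &
  forall eta0 : R, 0 < eta0 <= eta_max ->
  exists2 sigma0 : R, 0 < sigma0 <= delta &
  forall (H : forall m, set ((X m * Y m) * (X (u m) * Y (u m))))
    (F : forall m, X m -> Y (u m) -> X (u m))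
    (G : forall m, X m -> Y (u m) -> Y m),
  hyp_corr r1 r1' r2 r2' H F G ->
  (hyp_ii r1 r2' H F G eps1 alpha beta beta' lu ls \/
   hyp_ii' H eps1 alpha alpha' beta beta' lu ls) ->
  forall eta : M -> R,
  hyp_i F G eps1 eta -> (supf eta <= eta0%:E)%E ->
  exists f : forall m, X m -> Y m,
    unique_solution sigma0 H beta' ls eta f /\
    (forall eta' eps' : M -> R,
       nonneg eta' ->
       (forall m, [/\ eta' (u m) <= eps' m * eta' m, eps' m <= eps1 m
                    & eta m <= eta' m <= eta0]) ->
       unique_solution sigma0 H beta' ls eta' f).
Proof.
move=> delta delta_gt0.
have [s1 s1_gt0 lipP] :
  @solvable_under R M X Y u r1 r1' r2 r2' eps1 beta' ls (fun H F G =>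
    hyp_ii r1 r2' H F G eps1 alpha beta beta' lu ls).
  exact: solvable_lip.
have [s2 s2_gt0 coneP] :
  @solvable_under R M X Y u r1 r1' r2 r2' eps1 beta' ls (fun H F G =>
    hyp_ii' H eps1 alpha alpha' beta beta' lu ls).
  exact: solvable_cone.
(* The radius is fixed first, since the thresholds [e1] and [e2] depend on it; the same radius then
   serves every [eta0] below both. *)
pose sigma := Num.min delta (Num.min s1 s2).
have sigma_gt0 : 0 < sigma by rewrite !lt_min delta_gt0 s1_gt0.
have [|e1 e1_gt0 {}lipP] := lipP sigma.
  by rewrite sigma_gt0 !ge_min lexx /= orbT.
have [|e2 e2_gt0 {}coneP] := coneP sigma.
  by rewrite sigma_gt0 !ge_min lexx !orbT.
exists (Num.min e1 e2); first by rewrite lt_min e1_gt0.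
move=> eta0 /andP[_]; rewrite le_min => /andP[eta0_1 eta0_2].
exists sigma; first by rewrite sigma_gt0 ge_min lexx.
move=> H F G HFG [ii|ii'] eta hi sup_eta.
  exact: (lipP eta0 eta0_1 H F G eta).
exact: (coneP eta0 eta0_2 H F G eta).
Qed.
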